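(* Let $r\ge1$, $\mathbf{a},\mathbf{b}\in\mathbb{C}^r$ with $a_i-a_j\notin\mathbb{Z}$ for $i\neq j$, $\mathbf{m},\mathbf{n}\in\mathbb{Z}^r$, $M=\sum_i m_i$, $N=\sum_i n_i$, $m_{\min}=\min_i m_i$, $n_{\max}=\max_i n_i$, $p=\max\{-1,M-N-r+1\}$, $\nu=\sum_{i=1}^{r}(b_i-a_i)$, and assume all expressions below are well defined (e.g. $b_j-a_i\notin\mathbb{Z}$ for all $i,j$). Suppose $$\mathrm{Re}(\nu)-M+N-1<0,\qquad -\mathrm{Re}(\nu)+r-1<0.$$ Then the numbers $$\beta_{k}=\sum_{j=\max(-n_{\max},\,k-p-1)}^{k}\binom{p+1}{k-j}(-1)^{k-j}\sum_{i=1}^{r}\frac{(1-\mathbf{b}+a_i)_{\mathbf{m}+j}}{(a_i-\mathbf{a}_{[i]})_{\mathbf{n}_{[i]}+j+1}\,(j+n_i)!}\;{}_{2r}F_{2r-1}\!\left(\begin{matrix}-j-n_i,\;\mathbf{b}-a_i,\;1+\mathbf{a}_{[i]}-a_{i}-\mathbf{n}_{[i]}-j-1\\\mathbf{b}-a_{i}-\mathbf{m}-j,\;1+\mathbf{a}_{[i]}-a_{i}\end{matrix}\right)$$ (each term with $j+n_i<0$ being taken as zero) satisfy $$\sum_{k=-n_{\max}}^{p-m_{\min}}\beta_k=(-1)^{r-1}(\nu)_{1-r}(1-\nu)_{M-N}.$$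
   Context: For $k\in\mathbb{Z}$, $(c)_k=\Gamma(c+k)/\Gamma(c)$ (so $(c)_{-k}=(-1)^k/(1-c)_k$ for $k>0$). For vectors of equal length $(\mathbf{u})_{\mathbf{k}}=\prod_j(u_j)_{k_j}$; sums of a vector and a scalar are componentwise; $\mathbf{u}_{[i]}$ is $\mathbf{u}$ with the $i$-th component removed. Thus $(1-\mathbf{b}+a_i)_{\mathbf{m}+j}=\prod_{l=1}^r(1-b_l+a_i)_{m_l+j}$ and $(a_i-\mathbf{a}_{[i]})_{\mathbf{n}_{[i]}+j+1}=\prod_{l\ne i}(a_i-a_l)_{n_l+j+1}$. Vectors in hypergeometric parameter lists denote the lists of their components; ${}_{2r}F_{2r-1}$ is the (here terminating) generalized hypergeometric series $\sum_{s\ge0}\frac{(\mathbf{u})_s}{(\mathbf{v})_s\,s!}$ at unit argument. *)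

(* Defs.v *)
From HB Require Import structures.
From mathcomp Require Import all_boot all_order all_algebra.
From mathcomp Require Import reals.
From mathcomp Require Import complex.
From mathcomp Require Import zify ring lra.

Set Implicit Arguments.
Unset Strict Implicit.
Unset Printing Implicit Defensive.

Import Order.TTheory GRing.Theory Num.Theory.
Local Open Scope ring_scope.

Definition poch (F : fieldType) (c : F) (k : nat) : F :=
  \prod_(t < k) (c + t%:R).

(* (c)_k = Gamma (c + k) / Gamma c for k in Z, with
   (c)_(-k) = (-1)^k / (1 - c)_k for k > 0; recall Negz k = - k.+1. *)
Definition pochz (F : fieldType) (c : F) (k : int) : F :=
  match k with
  | Posz k => poch c k
  | Negz k => (-1) ^+ k.+1 / poch (1 - c) k.+1
  end.

(* Division by 0 is total: this says that pochz c k has no zero denominator. *)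
Definition pochz_wd (F : fieldType) (c : F) (k : int) : Prop :=
  match k with
  | Posz _ => True
  | Negz k => poch (1 - c) k.+1 != 0
  end.

(* Partial sum, up to s = K, of the generalized hypergeometric series with
   upper parameters us and lower parameters vs at unit argument. When - K is
   one of the upper parameters, this is the whole series (see hyper_stable). *)
Definition hyper (F : fieldType) (K : nat) (us vs : seq F) : F :=
  \sum_(s < K.+1)
    (\prod_(u <- us) poch u s) / (\prod_(v <- vs) poch v s * s`!%:R).

(* The integers lo, lo + 1, ..., hi (none if hi < lo). *)
Definition zrange (lo hi : int) : seq int :=
  if lo <= hi then [seq lo + t%:Z | t <- iota 0 `|hi - lo|.+1] else [::].

(* The defaults [head 0 _] only matter for r = 0. *)
Definition vmin (r : nat) (u : 'I_r -> int) : int :=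
  \big[Num.min/head 0 (codom u)]_(x <- codom u) x.

Definition vmax (r : nat) (u : 'I_r -> int) : int :=
  \big[Num.max/head 0 (codom u)]_(x <- codom u) x.

Definition nu (F : fieldType) (r : nat) (a b : 'I_r -> F) : F :=
  \sum_i (b i - a i).

Definition pdeg (r : nat) (m n : 'I_r -> int) : int :=
  Num.max (-1) (\sum_i m i - \sum_i n i - r%:Z + 1).

Definition upper_params (F : fieldType) (r : nat) (a b : 'I_r -> F)
    (n : 'I_r -> int) (i : 'I_r) (j : int) : seq F :=
  (- j - n i)%:~R :: [seq b l - a i | l <- enum 'I_r]
  ++ [seq 1 + a l - a i - (n l)%:~R - j%:~R - 1 | l <- enum 'I_r & l != i].

Definition lower_params (F : fieldType) (r : nat) (a b : 'I_r -> F)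
    (m : 'I_r -> int) (i : 'I_r) (j : int) : seq F :=
  [seq b l - a i - (m l)%:~R - j%:~R | l <- enum 'I_r]
  ++ [seq 1 + a l - a i | l <- enum 'I_r & l != i].

Definition summand (F : fieldType) (r : nat) (a b : 'I_r -> F)
    (m n : 'I_r -> int) (i : 'I_r) (j : int) : F :=
  if 0 <= j + n i then
    (\prod_l pochz (1 - b l + a i) (m l + j))
    / ((\prod_(l | l != i) pochz (a i - a l) (n l + j + 1))
       * (absz (j + n i))`!%:R)
    * hyper (absz (j + n i)) (upper_params a b n i j) (lower_params a b m i j)
  else 0.

Definition beta (F : fieldType) (r : nat) (a b : 'I_r -> F)
    (m n : 'I_r -> int) (k : int) : F :=
  let p := pdeg m n in
  \sum_(j <- zrange (Num.max (- vmax n) (k - p - 1)) k)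
    'C(absz (p + 1)%R, absz (k - j)%R)%:R * (-1) ^ (k - j)
    * \sum_i summand a b m n i j.

(* No denominator vanishes in the (i, j) summand of beta. *)
Definition summand_wd (F : fieldType) (r : nat) (a b : 'I_r -> F)
    (m n : 'I_r -> int) (i : 'I_r) (j : int) : Prop :=
  [/\ forall l, pochz_wd (1 - b l + a i) (m l + j),
      forall l, l != i -> pochz_wd (a i - a l) (n l + j + 1)
                       /\ pochz (a i - a l) (n l + j + 1) != 0
    & forall s v, (s <= absz (j + n i)%R)%N -> v \in lower_params a b m i j ->
        poch v s != 0].

(* All expressions in the summation formula are well defined: the range of j
   below is the one covered by beta k for - vmax n <= k <= pdeg m n - vmin m,
   and the last two conditions concern the closed form of the sum. *)
Definition well_defined (F : fieldType) (r : nat) (a b : 'I_r -> F)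
    (m n : 'I_r -> int) : Prop :=
  [/\ forall i j, - vmax n <= j <= pdeg m n - vmin m -> 0 <= j + n i ->
        summand_wd a b m n i j,
      pochz_wd (nu a b) (1 - r%:Z)
    & pochz_wd (1 - nu a b) (\sum_i m i - \sum_i n i)].

Lemma mem_zrange (lo hi k : int) : (k \in zrange lo hi) = (lo <= k <= hi).
Proof.
rewrite /zrange; case: ifPn => [lohi|]; last first.
  by rewrite -ltNge in_nil => hilo; apply/esym/negP => /andP[h1 h2];
     have := le_lt_trans (le_trans h1 h2) hilo; rewrite ltxx.
have hE : (`|hi - lo|%N : int) = hi - lo by rewrite gez0_abs // subr_ge0.
apply/mapP/andP => [[t]|[h1 h2]].
  rewrite mem_iota add0n /= ltnS -lez_nat hE => ht ->.
  by rewrite lerDl /= -lerBrDl.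
exists `|k - lo|%N; last by rewrite gez0_abs ?subr_ge0 // subrKC.
rewrite mem_iota add0n /= ltnS -lez_nat hE gez0_abs ?subr_ge0 //.
by rewrite lerD2r.
Qed.

Lemma hyper_stable (F : fieldType) (K L : nat) (us vs : seq F) :
  - K%:R \in us -> (K <= L)%N -> hyper L us vs = hyper K us vs.
Proof.
move=> Kus KL; rewrite /hyper.
rewrite -(big_mkord xpredT (fun s => (\prod_(u <- us) poch u s) /
  (\prod_(v <- vs) poch v s * s`!%:R))) (big_cat_nat (n := K.+1)) //= big_mkord.
rewrite [X in _ + X]big_nat_cond [X in _ + X]big1 ?addr0 // => s.
rewrite andbT => /andP[Ks _].
suff -> : \prod_(u <- us) poch u s = 0 by rewrite mul0r.
rewrite (big_rem _ Kus) /= /poch.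
by rewrite (bigD1 (Ordinal Ks)) //= addNr !mul0r.
Qed.

Lemma poch_neq0 (F : fieldType) (c : F) (k : nat) :
  (forall t, (t < k)%N -> c != - t%:R) -> poch c k != 0.
Proof.
by move=> ck; apply/prodf_neq0 => t _; rewrite addr_eq0; apply: ck.
Qed.

Lemma poch_nonint (F : fieldType) (c : F) (k : nat) :
  (forall z : int, c != z%:~R) -> poch c k != 0.
Proof.
by move=> cZ; apply: poch_neq0 => t _; have := cZ (- t%:Z); rewrite mulrNz.
Qed.

Lemma pochz_nonint (F : fieldType) (c : F) (k : int) :
  (forall z : int, c != z%:~R) -> pochz_wd c k /\ pochz c k != 0.
Proof.
move=> cZ; have cZ' (z : int) : 1 - c != z%:~R.
  apply: contra (cZ (1 - z)) => /eqP h.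
  by rewrite intrB -h mulr1z subKr.
case: k => k /=; first by split=> //; apply: poch_nonint.
have h := poch_nonint k.+1 cZ'.
by split=> //; rewrite mulf_neq0 ?invr_eq0 // signr_eq0.
Qed.

(* The generic case b_j - a_i \notin Z is an instance of well_defined. *)
Lemma generic_well_defined (R : realType) (r : nat) (a b : 'I_r -> R[i])
    (m n : 'I_r -> int) :
  (0 < r)%N ->
  (forall i j, i != j -> forall z : int, a i - a j != z%:~R) ->
  (forall i j (z : int), b j - a i != z%:~R) ->
  - complex.Re (nu a b) + r%:R - 1 < 0 ->
  well_defined a b m n.
Proof.
move=> r_gt0 aZ bZ hnu.
have shift (F : fieldType) (c : F) (w : int) : (forall z : int, c != z%:~R) ->
    forall z : int, c + w%:~R != z%:~R.
  move=> cZ z; apply: contra (cZ (z - w)) => /eqP h.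
  by rewrite intrB -h addrK.
have opp (F : fieldType) (c : F) : (forall z : int, c != z%:~R) ->
    forall z : int, - c != z%:~R.
  move=> cZ z; apply: contra (cZ (- z)) => /eqP h.
  by rewrite mulrNz -h opprK.
have Ren t : complex.Re (t%:R : R[i]) = t%:R by rewrite raddfMn.
have hr : r%:R < complex.Re (nu a b) + 1 by lra.
have r1 : (1 : R) <= r%:R by rewrite ler1n.
split.
- move=> i j _ _; split=> [l|l li|s v _].
  + apply: (proj1 (pochz_nonint _ _)) => z.
    have -> : 1 - b l + a i = - (b l - a i) + 1%:~R by ring.
    exact/shift/opp.
  + by apply: pochz_nonint; apply: aZ; rewrite eq_sym.
  + rewrite mem_cat => /orP[] /mapP[l hl ->]; apply: poch_nonint => z.
      have -> : b l - a i - (m l)%:~R - j%:~R = b l - a i + (- m l - j)%:~R.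
        by rewrite intrB mulrNz addrA.
      exact: shift.
    move: hl; rewrite mem_filter => /andP[li _].
    have -> : 1 + a l - a i = a l - a i + 1%:~R by ring.
    by apply: shift; apply: aZ.
- case E: (1 - r%:Z) => [//|k] /=.
  have rk : r = k.+2 by lia.
  apply: poch_neq0 => t tk; apply/eqP => h.
  have {}h : nu a b = t.+1%:R.
    by rewrite -natr1 -[t%:R]opprK -h opprB subrK.
  by move: hr; rewrite h Ren natr1 ltr_nat rk; lia.
- case: (\sum_i m i - _) => k //=.
  rewrite subKr; apply: poch_neq0 => t _; apply/eqP => h.
  have ReN : complex.Re (nu a b) = - t%:R by rewrite h raddfN /= Ren.
  have t0 : (0 : R) <= t%:R by [].
  lra.
Qed.

(* Main.v *)
(* The summand of index (i, j) is the sum, over the poles a_i, a_i - 1, ...,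
   of the residues of
     R_j(x) = prod_l (1 - b_l + x)_{m_l + j} / (x - a_l)_{n_l + j + 1}.
   For j >= - min m the R_j have no other poles, so the sum S_j over i is the
   coefficient of 1/x in the expansion of R_j at infinity.  The hypotheses on
   Re nu force p = M - N - r + 1 >= 0, and the sum of the beta_k telescopes to
   the p-th forward difference of S_j at j = - min m.  Now R_j(x) has the form
   f(x + j) / g(x) with f(u + 1) / f(u) = 1 + (M - N - nu) / u + ..., so each
   difference in j lowers the degree at infinity by one: the p-th difference of
   R_j is equivalent to c / x with c = prod_{i < p} (M - N - nu - i). *)

Require Import Defs.
From mathcomp Require Import all_boot all_order all_algebra.
From mathcomp Require Import reals complex.
From mathcomp Require Import zify ring lra.

Set Implicit Arguments.
Unset Strict Implicit.
Unset Printing Implicit Defensive.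

Import Order.TTheory GRing.Theory Num.Theory.
Local Open Scope ring_scope.

(** * Pochhammer symbols and shifts of their argument *)

Section Poch.
Variable F : fieldType.
Implicit Types c : F.

Lemma pochD c k l : poch c (k + l) = poch c k * poch (c + k%:R) l.
Proof.
rewrite /poch big_split_ord; congr (_ * _).
by apply: eq_bigr => t _ /=; rewrite natrD addrA.
Qed.

Lemma poch_reflect c k : poch (1 - c) k = (-1) ^+ k * poch (c - k%:R) k.
Proof.
rewrite /poch (reindex_inj rev_ord_inj) -[X in _ ^+ X]card_ord.
rewrite -prodr_const -big_split /=; apply: eq_bigr => t _.
by rewrite natrB // -natr1; ring.
Qed.

(** After reflection, clearing the denominator leaves (c - s)_{k + s} on both sides, with the same
    sign, split at two different places. This moves the summation index s of the series into the
    argument. *)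
Lemma poch_shift c k s : poch (1 - c - k%:R) s != 0 ->
  poch c k * poch (1 - c) s / poch (1 - c - k%:R) s = poch (c - s%:R) k.
Proof.
move=> h; apply: canLR (mulfK h) _.
have -> : 1 - c - k%:R = 1 - (c + k%:R) by ring.
rewrite !poch_reflect mulrCA [RHS]mulrCA; congr (_ * _).
have -> : c + k%:R - s%:R = c - s%:R + k%:R by ring.
by rewrite -pochD addnC pochD subrK mulrC.
Qed.

Lemma pochzD c (k : int) e K : k + e%:Z = K%:Z -> pochz_wd c k ->
  pochz c k * poch (c + k%:~R) e = poch c K.
Proof.
case: k => k kK wdk.
  have -> : K = (k + e)%N by lia.
  by rewrite pochD.
have -> : e = (k.+1 + K)%N by lia.
have -> : c + (Negz k)%:~R = c - k.+1%:R by rewrite NegzE mulrNz.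
rewrite pochD subrK mulrA -[RHS]mul1r; congr (_ * _).
move: wdk; rewrite /pochz_wd /pochz poch_reflect mulf_eq0 negb_or => /andP[h1 h2].
by rewrite invfM mulrA mulfV // mul1r mulVf.
Qed.

(** The counterpart of [poch_shift] for denominators and an index of either sign: both sides are 1 /
    (c - s)_k, the right one written with natural indices only. *)
Lemma pochz_shift c (k : int) e K s : (forall z : int, c != z%:~R) ->
  k + e%:Z = K%:Z ->
  poch (1 - c - k%:~R) s / (pochz c k * poch (1 - c) s)
  = poch (c - s%:R + k%:~R) e / poch (c - s%:R) K.
Proof.
move=> cZ kK.
have sh (w : int) : forall z : int, c + w%:~R != z%:~R.
  by move=> z; apply: contra (cZ (z - w)) => /eqP h; rewrite intrB -h addrK.
have n1 l : poch (1 - c) l != 0.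
  apply: poch_nonint => z; apply: contra (cZ (1 - z)) => /eqP h.
  by rewrite intrB -h mulr1z subKr.
have [wdk n2] := pochz_nonint k cZ.
have n3 : poch (c + k%:~R) e != 0 by apply/poch_nonint/sh.
have n4 l : poch (c - s%:R) l != 0.
  by apply: poch_nonint; have := sh (- s%:Z); rewrite mulrNz.
apply/eqP; rewrite eqr_div ?mulf_neq0 //; apply/eqP.
apply: (mulIf n3); rewrite mulrC mulrA.
have -> : poch (c - s%:R + k%:~R) e * (pochz c k * poch (1 - c) s) *
  poch (c + k%:~R) e = poch (c - s%:R + k%:~R) e * poch (1 - c) s * poch c K.
  by rewrite -(pochzD kK wdk); ring.
have -> : 1 - c - k%:~R = 1 - (c + k%:~R) by ring.
rewrite !poch_reflect.
have e1 : poch (c + k%:~R - s%:R) s * poch (c + k%:~R) e =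
   poch (c - s%:R + k%:~R) e * poch (c - s%:R + K%:R) s.
  have -> : c - s%:R + K%:R = c - s%:R + k%:~R + e%:R.
    by rewrite -[K%:R]/(K%:Z%:~R) -kK intrD !addrA.
  rewrite -pochD [RHS]pochD /= ?[(e + s)%N]addnC.
  have -> : c - s%:R + k%:~R = c + k%:~R - s%:R by ring.
  by rewrite -pochD addnC pochD subrK.
have e2 : poch (c - s%:R) s * poch c K
          = poch (c - s%:R) K * poch (c - s%:R + K%:R) s.
  by rewrite -pochD addnC pochD subrK.
ring: e1 e2.
Qed.
End Poch.

(** * Residue sums and finite differences *)

(** Lagrange interpolation: [P] and its interpolant [Q] agree at [#|I|] nodes, and each [L i] is
    monic of degree [#|I|.-1]. The left side is the sum of the residues of P / prod_i (x - y_i), the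
    right side its coefficient of 1/x at infinity. *)
Lemma sum_residues (F : fieldType) (I : finType) (y : I -> F) (P : {poly F}) :
  injective y -> (size P <= #|I|)%N ->
  \sum_i P.[y i] / \prod_(j | j != i) (y i - y j) = P`_(#|I|.-1).
Proof.
move=> y_inj szP.
pose L i := \prod_(j | j != i) ('X - (y j)%:P).
have LE i k : (L i).[y k] = \prod_(j | j != i) (y k - y j).
  by rewrite horner_prod; apply: eq_bigr => j _; rewrite !hornerE.
have L0 i : \prod_(j | j != i) (y i - y j) != 0.
  by apply/prodf_neq0 => j ji; rewrite subr_eq0 (inj_eq y_inj) eq_sym.
have szL i : size (L i) = #|I|.
  rewrite /L -big_filter size_prod_XsubC size_filter -sum1_count.
  by rewrite (sum1_card (predC1 i)) cardC1 prednK //; apply/card_gt0P; exists i.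
pose Q := \sum_i (P.[y i] / \prod_(j | j != i) (y i - y j)) *: L i.
have QE : P = Q.
  apply/eqP; rewrite -subr_eq0; apply/eqP.
  apply: (@roots_geq_poly_eq0 _ _ [seq y i | i <- enum I]).
  - apply/allP => _ /mapP[k _ ->]; rewrite /root hornerD hornerN horner_sum.
    rewrite (bigD1 k) //= [X in - (_ + X)]big1 ?addr0 => [|i ik].
      by rewrite hornerZ LE divfK ?subrr.
    rewrite hornerZ LE [X in _ * X](bigD1 k) 1?eq_sym //=.
    by rewrite subrr mul0r mulr0.
  - by rewrite map_inj_uniq ?enum_uniq.
  - rewrite size_map -cardE (leq_trans (size_polyD _ _)) // geq_max szP /=.
    rewrite size_polyN (leq_trans (size_sum _ _ _)) //; apply/bigmax_leqP => i _.
    by rewrite (leq_trans (size_scale_leq _ _)) ?szL.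
rewrite [in RHS]QE coef_sum; apply: eq_bigr => i _.
rewrite coefZ -(szL i) -lead_coefE (monicP _) ?mulr1 //.
exact: monic_prod_XsubC.
Qed.

(** By Pascal's rule, alternating partial sums of row p + 1 of the binomial triangle are entries of
    row p up to sign, so summation undoes one difference. *)
Lemma sum_backward_diff (R : comPzRingType) (f : nat -> R) (p n : nat) :
  \sum_(k < n.+1) \sum_(j < k.+1) 'C(p.+1, k - j)%:R * (-1) ^+ (k - j) * f j
  = \sum_(j < n.+1) 'C(p, n - j)%:R * (-1) ^+ (n - j) * f j.
Proof.
elim: n => [|n IH]; first by rewrite !big_ord1 !subnn !bin0.
rewrite big_ord_recr IH [X in _ + X = _]big_ord_recr [in RHS]big_ord_recr /=.
rewrite addrA -big_split /= subnn !bin0; congr (_ + _).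
apply: eq_bigr => j _; rewrite subSn -1?ltnS // binS natrD exprS.
ring.
Qed.

Lemma forward_diffS (R : comPzRingType) (f : nat -> R) (k t : nat) :
  \sum_(i < k.+2) 'C(k.+1, i)%:R * (-1) ^+ (k.+1 - i) * f (t + i)%N
  = \sum_(i < k.+1) 'C(k, i)%:R * (-1) ^+ (k - i) * f (t.+1 + i)%N
  - \sum_(i < k.+1) 'C(k, i)%:R * (-1) ^+ (k - i) * f (t + i)%N.
Proof.
rewrite big_ord_recl /= [X in _ + X = _](_ : _ =
  \sum_(i < k.+1) 'C(k, i)%:R * (-1) ^+ (k - i) * f (t.+1 + i)%N
  + \sum_(i < k.+1) 'C(k, i.+1)%:R * (-1) ^+ (k - i) * f (t + i.+1)%N).
  rewrite addrCA; congr (_ + _).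
  rewrite big_ord_recr /= (bin_small (ltnSn k)) !mul0r addr0.
  rewrite [X in _ = - X]big_ord_recl opprD /= !bin0 !subn0 exprS; congr (_ + _).
    by rewrite !mul1r mulN1r mulNr.
  rewrite -sumrN; apply: eq_bigr => i _.
  by rewrite /bump add1n -(subnSK (ltn_ord i)) exprS; ring.
rewrite -big_split; apply: eq_bigr => i _ /=.
by rewrite /bump add1n binS subSS natrD addnS addSn; ring.
Qed.

(** * Rising factorials as polynomials, and top coefficients *)

Section RisingPoly.
Variable F : fieldType.
Implicit Types (c x : F) (p q : {poly F}).

Definition rpoly c k : {poly F} := \prod_(t < k) ('X + (c + t%:R)%:P).

Lemma horner_rpoly c k x : (rpoly c k).[x] = poch (x + c) k.
Proof.
rewrite horner_prod; apply: eq_bigr => t _.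
by rewrite hornerD hornerX hornerC addrA.
Qed.

Lemma rpolyD c k l : rpoly c (k + l) = rpoly c k * rpoly (c + k%:R) l.
Proof.
rewrite /rpoly big_split_ord; congr (_ * _).
by apply: eq_bigr => t _ /=; rewrite natrD addrA.
Qed.

Lemma rpoly1 c : rpoly c 1 = 'X + c%:P.
Proof. by rewrite /rpoly big_ord1 addr0. Qed.

Lemma rpoly_monic c k : rpoly c k \is monic.
Proof. by apply: monic_prod => t _; rewrite monicE lead_coefXaddC. Qed.

Lemma size_rpoly c k : size (rpoly c k) = k.+1.
Proof.
rewrite /rpoly size_prod => [|t _]; last by rewrite -size_poly_eq0 size_XaddC.
rewrite (eq_bigr (fun=> 2)) => [|t _]; last exact: size_XaddC.
by rewrite sum_nat_const card_ord; lia.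
Qed.

(* The coefficients of [q] in degrees [d] and [d - 1], the latter read off
   [q * 'X] so that it is 0 when [d = 0]. *)
Definition top2 d q h e := [/\ (size q <= d.+1)%N, q`_d = h & (q * 'X)`_d = e].

Lemma top2_linear d q h e c :
  top2 d q h e -> top2 d.+1 (('X + c%:P) * q) h (e + c * h).
Proof.
case=> szq <- <-; split.
- by rewrite (leq_trans (size_polyMleq _ _)) // size_XaddC.
- by rewrite mulrDl coefD coefXM coefCM /= (nth_default _ szq) mulr0 addr0.
- by rewrite mulrDl !coefMX /= coefD coefXM coefCM.
Qed.

Lemma top2_prod (I : Type) (s : seq I) (c : I -> F) d q h e : top2 d q h e ->
  top2 (size s + d) ((\prod_(l <- s) ('X + (c l)%:P)) * q) h
       (e + (\sum_(l <- s) c l) * h).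
Proof.
move=> t2; elim: s => [|l s IH]; first by rewrite !big_nil mul1r mul0r addr0.
rewrite !big_cons -mulrA [c l + _]addrC [_ * h]mulrDl addrA.
exact: top2_linear.
Qed.

(** Writing q = X q1 + q_0 gives q(X + 1) = (X + 1) q1(X + 1) + q_0, so the induction gains one [h]
    per degree from [top2_linear] with c = 1. *)
Lemma top2_shift d q h e :
  top2 d q h e -> top2 d (q \Po ('X + 1%:P)) h (e + d%:R * h).
Proof.
elim: d q h e => [|d IH] q h e [szq <- <-].
  have /size1_polyC -> := szq.
  rewrite comp_polyC mul0r addr0; split=> //.
  exact: (leq_trans (size_polyC_leq1 _)).
have qE : q = drop_poly 1 q * 'X + (q`_0)%:P.
  apply/polyP => -[|i]; rewrite coefD coefMX coefC ?add0r //= addr0.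
  by rewrite coef_drop_poly addn1.
have szq0 : (size (drop_poly 1 q) <= d.+1)%N.
  by rewrite size_drop_poly leq_subLR.
have [h1 h2 h3] := IH _ _ _ (And3 szq0 erefl erefl).
have -> : q \Po ('X + 1%:P) =
  ('X + 1%:P) * (drop_poly 1 q \Po ('X + 1%:P)) + (q`_0)%:P.
  by rewrite {1}qE comp_polyD comp_polyM comp_polyC comp_polyX mulrC.
have [g1 g2 g3] := top2_linear 1 (And3 h1 h2 h3).
split.
- rewrite (leq_trans (size_polyD _ _)) // geq_max g1 /=.
  by rewrite (leq_trans (size_polyC_leq1 _)).
- by rewrite coefD g2 coefC addr0 coef_drop_poly addn1.
- rewrite mulrDl coefD g3 mul1r coefMX.
  rewrite [in RHS]qE mulrDl coefD !coefMX /= coefD coefMX.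
  rewrite !coef_drop_poly !coefC !addn1 /= -natr1; ring.
Qed.

Lemma coefM_top d e p q : (size p <= d.+1)%N -> (size q <= e.+1)%N ->
  (p * q)`_(d + e) = p`_d * q`_e.
Proof.
move=> szp szq; rewrite coefM.
have dlt : (d < (d + e).+1)%N by lia.
rewrite (bigD1 (Ordinal dlt)) //= addKn big1 ?addr0 // => j jd.
have {}jd : (j : nat) <> d by move=> h; case/eqP: jd; apply: val_inj.
have [jltd|] := ltnP j d; last first.
  by move=> ?; rewrite nth_default ?mul0r // (leq_trans szp) //; lia.
by rewrite [q`__]nth_default ?mulr0 // (leq_trans szq) //; lia.
Qed.
End RisingPoly.

(** * Iterated differences of the numerators *)

Section Difference.
Variables (F : fieldType) (r : nat) (u v : 'I_r -> F) (m : 'I_r -> nat).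
Variable J : nat.

(* [numer t] is R_t times a denominator that does not depend on t.  Its k-th
   forward difference in t is [common k t], still a product of linear factors,
   times [cofactor k] evaluated at x + t. *)
Definition numer t : {poly F} :=
  \prod_l (rpoly (u l) (m l + t) * rpoly (v l + t%:R) (J - t)).

Definition common k t : {poly F} :=
  \prod_l (rpoly (u l) (m l + t) * rpoly (v l + (t + k)%:R) (J - (t + k))).

Fixpoint cofactor k : {poly F} :=
  if k is k'.+1 then
    (\prod_l ('X + (u l + (m l)%:R)%:P)) * (cofactor k' \Po ('X + 1%:P))
    - (\prod_l ('X + (v l + k'%:R)%:P)) * cofactor k'
  else 1.

(** Both [common k t.+1] and [common k t] are [common k.+1 t] times linear factors, x + t + u_l +
    m_l and x + t + v_l + k respectively. These depend on x and t through x + t alone, whence the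
    recursion for [cofactor]. *)
Lemma diff_numer k t : (t + k <= J)%N ->
  \sum_(i < k.+1) 'C(k, i)%:R * (-1) ^+ (k - i) * numer (t + i)
  = common k t * (cofactor k \Po ('X + t%:R%:P)).
Proof.
elim: k t => [|k IH] t tk.
  rewrite big_ord1 subnn expr0 bin0 !mul1r addn0 comp_polyC mulr1.
  by rewrite /common addn0.
rewrite forward_diffS !IH; try lia.
have -> : common k t.+1 = common k.+1 t * \prod_l ('X + (u l + (m l + t)%:R)%:P).
  rewrite -big_split; apply: eq_bigr => l _ /=.
  have -> : (m l + t.+1 = m l + t + 1)%N by lia.
  by rewrite addSnnS rpolyD rpoly1 mulrAC.
have -> : common k t = common k.+1 t * \prod_l ('X + (v l + (t + k)%:R)%:P).
  rewrite -big_split; apply: eq_bigr => l _ /=.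
  have -> : (J - (t + k) = 1 + (J - (t + k.+1)))%N by lia.
  rewrite [rpoly (v l + _) _]rpolyD rpoly1 -addrA natr1 -addnS; ring.
rewrite /= comp_polyB !comp_polyM !rmorph_prod /= mulrBr !mulrA.
congr (_ * _ * _ - _ * _ * _).
- apply: eq_bigr => l _; rewrite comp_polyD comp_polyX comp_polyC natrD.
  by rewrite -addrA -polyCD; congr ('X + _%:P); ring.
- rewrite -comp_polyA comp_polyD comp_polyX comp_polyC -addrA -polyCD.
  by rewrite natr1.
- apply: eq_bigr => l _; rewrite comp_polyD comp_polyX comp_polyC natrD.
  by rewrite -addrA -polyCD; congr ('X + _%:P); ring.
Qed.
End Difference.

(** The two products in the recursion have the same leading term, so the degree grows by r instead
    of r + 1. In the difference of the next coefficients [e] cancels, and the shifts contribute r k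
    - (r + 1) k = - k. *)
Lemma cofactor_top (F : fieldType) (r : nat) (u v : 'I_r.+1 -> F)
    (m : 'I_r.+1 -> nat) k :
  exists e, top2 (r * k) (cofactor u v m k)
    (\prod_(i < k) (\sum_l (u l + (m l)%:R - v l) - i%:R)) e.
Proof.
elim: k => [|k [e IH]].
  exists 0; rewrite big_ord0 muln0; split; rewrite ?size_poly1 ?coefC //=.
  by rewrite mul1r coefX.
set h := \prod_(i < k) _ in IH.
have szE : size (index_enum 'I_r.+1) = r.+1.
  by rewrite -sum1_size -[RHS]card_ord -sum1_card.
have := top2_prod (index_enum 'I_r.+1) (fun l => v l + k%:R) IH.
have := top2_prod (index_enum 'I_r.+1) (fun l => u l + (m l)%:R) (top2_shift IH).
rewrite szE addSn => -[a1 a2 a3] [b1 b2 b3].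
eexists; rewrite mulnS; split; last by [].
- apply/leq_sizeP => i; rewrite leq_eqVlt => /orP[/eqP <-|hi].
    by rewrite /= coefB a2 b2 subrr.
  by rewrite /= coefB !nth_default ?subrr // (leq_trans _ hi).
- move: a3 b3; rewrite !coefMX /= coefB => -> ->.
  rewrite [in RHS]big_ord_recr /= -/h sumrB !big_split /= !sumr_const card_ord natrM.
  rewrite -[_ *+ r.+1]mulr_natr -natr1. ring.
Qed.

(** [common] is monic, so the coefficient is that of [cofactor p]. The bound [d] is p less than the
    degree of each [numer]. *)
Lemma diff_numer_top (F : fieldType) (r : nat) (u v : 'I_r.+1 -> F)
    (m : 'I_r.+1 -> nat) (J p : nat) : (p <= J)%N ->
  let W := \sum_(i < p.+1) 'C(p, i)%:R * (-1) ^+ (p - i) * numer u v m J i in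
  let d := (\sum_l (m l + (J - p)) + r * p)%N in
  (size W <= d.+1)%N /\
  W`_d = \prod_(i < p) (\sum_l (u l + (m l)%:R - v l) - i%:R).
Proof.
move=> pJ W d.
have WE : W = common u v m J p 0 * cofactor u v m p.
  by rewrite -[cofactor _ _ _ _]comp_polyXr -[X in _ \Po X]addr0 -(@diff_numer _ _ _ _ _ _ p 0).
have [e [h1 h2 _]] := cofactor_top u v m p.
have mon : common u v m J p 0 \is monic.
  by apply: monic_prod => l _; rewrite monicMl ?rpoly_monic.
have sz : size (common u v m J p 0) = (\sum_l (m l + (J - p))).+1.
  rewrite /common size_prod => [|l _]; last first.
    by rewrite mulf_neq0 ?monic_neq0 ?rpoly_monic.
  rewrite (eq_bigr (fun l => (m l + (J - p)) + 1)%N) => [|l _].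
    by rewrite big_split /= sum_nat_const muln1 -addSn addnK.
  by rewrite size_monicM ?rpoly_monic ?monic_neq0 ?rpoly_monic // !size_rpoly; lia.
rewrite WE; split.
  by rewrite (leq_trans (size_polyMleq _ _)) // sz addSn /= -addnS leq_add2l.
rewrite coefM_top ?sz // h2.
by move: mon; rewrite monicE /lead_coef sz => /eqP ->; rewrite mul1r.
Qed.

(** * Summands as sums of residues *)

Lemma poch_fact (F : fieldType) k l :
  poch (k.+1%:R : F) l * k`!%:R = (k + l)`!%:R.
Proof.
elim: l => [|l IH]; first by rewrite /poch big_ord0 mul1r addn0.
rewrite -[l.+1]addn1 pochD mulrAC IH /poch big_ord1 addr0 -natrD -natrM.
by rewrite addn1 addnS factS mulnC addSn.
Qed.

Lemma poch_opp_nat (F : fieldType) q s : (s <= q)%N ->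
  poch (- q%:R : F) s * (q - s)`!%:R = (-1) ^+ s * q`!%:R.
Proof.
move=> sq; have -> : - q%:R = 1 - q.+1%:R :> F by rewrite -natr1; ring.
rewrite poch_reflect -natrB 1?leqW // subSn // -mulrA poch_fact.
by rewrite subnK.
Qed.

(** The part of a residue's denominator due to poles of the same progression: s factors before the
    node, u after it. *)
Lemma prod_sub_nat (F : fieldType) s u :
  \prod_(t < s + u.+1 | t != s :> nat) (t%:R - s%:R : F)
  = (-1) ^+ s * s`!%:R * u`!%:R.
Proof.
rewrite big_mkcond big_split_ord /= big_ord_recl /= addn0 eqxx mul1r.
congr (_ * _).
  rewrite -poch_opp_nat // subnn mulr1; apply: eq_bigr => t _.
  by rewrite ltn_eqF //= addrC.
rewrite -[RHS](poch_fact F 0 u) mulr1; apply: eq_bigr => t _.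
rewrite /bump add1n ifT; last by lia.
by rewrite natrD addrC addKr -natr1 addrC.
Qed.

Section SummandResidues.
Variables (F : numFieldType) (r : nat) (a b : 'I_r -> F) (m n : 'I_r -> int).
Hypothesis a_nonint :
  forall i j : 'I_r, i != j -> forall z : int, a i - a j != z%:~R.
Variables (K : 'I_r -> nat).

(** The zeros of prod_l (x - a_l)_{K_l}; dependent pairs are needed because their number varies with
    l. *)
Definition pole (w : {l : 'I_r & 'I_(K l)}) : F := a (tag w) - (tagged w)%:R.

Lemma pole_inj : injective pole.
Proof.
move=> [i s] [l t]; rewrite /pole /= => h.
have il : i = l.
  apply/eqP; apply: contraT => /a_nonint /(_ (s%:Z - t%:Z)) /eqP[].
  have -> : a i - a l = a i - s%:R - a l + s%:R by ring.
  by rewrite h intrB; ring.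
by subst l; move/addrI/oppr_inj/eqP: h; rewrite eqr_nat => /eqP/val_inj ->.
Qed.

Lemma prod_pole (i : 'I_r) (s : 'I_(K i)) :
  \prod_(w | w != Tagged (fun l => 'I_(K l)) s)
     (pole (Tagged (fun l => 'I_(K l)) s) - pole w)
  = (\prod_(l | l != i) poch (a i - s%:R - a l) (K l))
    * ((-1) ^+ s * s`!%:R * (K i - s.+1)`!%:R).
Proof.
rewrite -(@sig_big_dep _ _ _ _ (fun l => 'I_(K l)) xpredT
  (fun l t => Tagged (fun l => 'I_(K l)) t != Tagged (fun l => 'I_(K l)) s)
  (fun l t => pole (Tagged (fun l => 'I_(K l)) s)
     - pole (Tagged (fun l => 'I_(K l)) t))).
rewrite (bigD1 i) //= mulrC; congr (_ * _).
  apply: eq_bigr => l li; apply: eq_big => [t|t _].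
    by rewrite -tag_eqE /tag_eq /= (negPf li).
  by rewrite /pole /=; ring.
have KE : K i = (s + (K i - s.+1).+1)%N by have := ltn_ord s; lia.
rewrite -prod_sub_nat -(big_mkord (fun t => t != s :> nat)
  (fun t => t%:R - s%:R)) -KE big_mkord.
apply: eq_big => [t|t _]; first by rewrite eq_Tagged.
by rewrite /pole /=; ring.
Qed.

(** Padding numerator and denominator of R_j by (x - a_l + n_l + j + 1)_e turns the denominator into
    the polynomial prod_l (x - a_l)_{K_l}. The residue at a_i - s is the s-th term of the series, or
    0 if the padding created that pole. *)
Lemma summand_residues (i : 'I_r) (j : int) (e : nat) (M : 'I_r -> nat) :
  (forall l, m l + j = M l) -> (forall l, n l + j + 1 + e%:Z = K l) ->
  (0 <= j + n i -> forall s v, (s <= absz (j + n i)%R)%N ->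
     v \in lower_params a b m i j -> poch v s != 0) ->
  summand a b m n i j = \sum_(s < K i)
    (\prod_l (poch (a i - s%:R + (1 - b l)) (M l)
             * poch (a i - s%:R + (- a l + (n l + j + 1)%:~R)) e))
    / \prod_(w | w != Tagged (fun l => 'I_(K l)) s)
        (pole (Tagged (fun l => 'I_(K l)) s) - pole w).
Proof.
move=> ME KE wd; rewrite /summand.
have vanish (s : nat) : (s < K i)%N -> j + n i < s%:Z ->
    poch (a i - s%:R + (- a i + (n i + j + 1)%:~R)) e = 0 :> F.
  (* The padding factor of index s - (j + n_i + 1) is zero at a_i - s. *)
  move=> sK hs; have te : (`|(s%:Z - (j + n i + 1))%R| < e)%N.
    by have := KE i; lia.
  rewrite /poch (bigD1 (Ordinal te)) //= [X in X * _](_ : _ = 0) ?mul0r //.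
  rewrite -[X in _ + X]/(`|(s%:Z - (j + n i + 1))%R|%N%:Z%:~R) gez0_abs; last by lia.
  by rewrite !intrB !intrD; ring.
pose G s := (\prod_l (poch (a i - s%:R + (1 - b l)) (M l)
             * poch (a i - s%:R + (- a l + (n l + j + 1)%:~R)) e))
    / ((\prod_(l | l != i) poch (a i - s%:R - a l) (K l))
       * ((-1) ^+ s * s`!%:R * (K i - s.+1)`!%:R)).
rewrite [RHS](_ : _ = \sum_(s < K i) G s); last first.
  by apply: eq_bigr => s _; rewrite prod_pole.
have G0 (s : nat) : (s < K i)%N -> j + n i < s%:Z -> G s = 0.
  by move=> sK hs; rewrite /G (bigD1 i) //= vanish // mulr0 !mul0r.
(* If j + n_i < 0, all nodes of this progression come from padding, in agreement with the value 0 of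
   [summand]. *)
case: ifPn => [q0|]; last first.
  by rewrite -ltNge => q0; rewrite big1 // => s _; rewrite G0 //; lia.
have {wd} wd := wd q0.
case qE: (j + n i) q0 wd G0 => [q|//] _ wd G0.
have KqE : K i = (q.+1 + e)%N by have := KE i; lia.
rewrite -(big_mkord xpredT G) (big_cat_nat (n := q.+1)) //=; last by lia.
rewrite [X in _ = _ + X]big_nat_cond [X in _ = _ + X]big1 ?addr0; last first.
  by move=> s /andP[/andP[h1 h2] _]; apply: G0; lia.
rewrite big_mkord /hyper mulr_sumr; apply: eq_bigr => s _ /=.
have sq : (s <= q)%N by rewrite -ltnS.
rewrite /G /upper_params /lower_params big_cons !big_cat !big_map !big_filter.
have bE (P : pred 'I_r) (f : 'I_r -> F) :
    \prod_(l <- enum 'I_r | P l) f l = \prod_(l | P l) f l.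
  by rewrite big_enum_cond.
rewrite !bE big_split [X in _ = _ * X / _](bigD1 i) //=.
(* The terms are matched in three groups: the factors in [b], those in [a l] for l != i, and the
   factor l = i with the factorials. *)
have fB : (\prod_l pochz (1 - b l + a i) (m l + j)) * (\prod_l poch (b l - a i) s)
    / \prod_l poch (b l - a i - (m l)%:~R - j%:~R) s
    = \prod_l poch (a i - s%:R + (1 - b l)) (M l).
  rewrite -big_split -prodf_div; apply: eq_bigr => l _ /=.
  rewrite ME /=.
  have cE : b l - a i = 1 - (1 - b l + a i) by ring.
  have dE : b l - a i - (m l)%:~R - j%:~R = 1 - (1 - b l + a i) - (M l)%:R.
    by rewrite -[(M l)%:R]/((M l)%:Z%:~R) -ME intrD; ring.
  rewrite dE cE poch_shift; first by congr poch; ring.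
  rewrite -dE; apply: wd; first exact: sq.
  by rewrite mem_cat; apply/orP; left; apply/mapP; exists l; rewrite ?mem_enum.
have fA : (\prod_(l | l != i) poch (1 + a l - a i - (n l)%:~R - j%:~R - 1) s)
    / ((\prod_(l | l != i) pochz (a i - a l) (n l + j + 1))
       * \prod_(l | l != i) poch (1 + a l - a i) s)
    = (\prod_(l | l != i) poch (a i - s%:R + (- a l + (n l + j + 1)%:~R)) e)
      / \prod_(l | l != i) poch (a i - s%:R - a l) (K l).
  rewrite -big_split -!prodf_div; apply: eq_bigr => l li /=.
  have dE : 1 + a l - a i - (n l)%:~R - j%:~R - 1
      = 1 - (a i - a l) - (n l + j + 1)%:~R by rewrite !intrD; ring.
  have cE : 1 + a l - a i = 1 - (a i - a l) by ring.
  rewrite dE cE (pochz_shift s _ (KE l)); last by apply: a_nonint; rewrite eq_sym.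
  by congr (poch _ _ / poch _ _); ring.
(* Here (-q)_s = (-1)^s q! / (q - s)!, and the padding equals (K_i - s - 1)! / (q - s)!. *)
have fq : poch (- j - n i)%:~R s / (q`!%:R * s`!%:R)
    = poch (a i - s%:R + (- a i + (n i + j + 1)%:~R)) e
      / ((-1) ^+ s * s`!%:R * (K i - s.+1)`!%:R) :> F.
  have f0 k : k`!%:R != 0 :> F by rewrite pnatr_eq0 -lt0n fact_gt0.
  have -> : (- j - n i)%:~R = - q%:R :> F.
    by rewrite -[q%:R]/(q%:Z%:~R) -qE -opprD mulrNz.
  have -> : a i - s%:R + (- a i + (n i + j + 1)%:~R) = (q - s).+1%:R.
    rewrite -natr1 natrB // -[q%:R]/(q%:Z%:~R) -qE !intrD; ring.
  have -> : (K i - s.+1 = q - s + e)%N by lia.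
  apply/eqP; rewrite eqr_div ?mulf_neq0 ?signr_eq0 //; apply/eqP.
  apply: (mulIf (f0 (q - s)%N)).
  have h3 : (-1) ^+ s * (-1) ^+ s = 1 :> F.
    by rewrite -exprD addnn -signr_odd odd_double.
  have -> : q`!%:R = (-1) ^+ s * (poch (- q%:R) s * (q - s)`!%:R) :> F.
    by rewrite poch_opp_nat // mulrA h3 mul1r.
  rewrite -poch_fact; ring.
rewrite -fB.
transitivity (\prod_l pochz (1 - b l + a i) (m l + j) * \prod_l poch (b l - a i) s
    / \prod_l poch (b l - a i - (m l)%:~R - j%:~R) s
  * ((\prod_(l | l != i) poch (1 + a l - a i - (n l)%:~R - j%:~R - 1) s)
    / ((\prod_(l | l != i) pochz (a i - a l) (n l + j + 1))
       * \prod_(l | l != i) poch (1 + a l - a i) s))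
  * (poch (- j - n i)%:~R s / (q`!%:R * s`!%:R))).
  by rewrite !invfM; ring.
by rewrite fA fq !invfM; ring.
Qed.
End SummandResidues.

(** * Telescoping of the sum of the beta_k *)

Lemma zrange_uniq lo hi : uniq (zrange lo hi).
Proof.
rewrite /zrange; case: ifP => // _; rewrite map_inj_uniq ?iota_uniq //.
by move=> x y /addrI [].
Qed.

Lemma sum_zrange (V : nmodType) (lo lo' : int) (T : nat) (f : int -> V) :
  lo <= lo' -> (forall k, k < lo' -> f k = 0) ->
  \sum_(k <- zrange lo' (lo + T%:Z)) f k = \sum_(t < T.+1) f (lo + t%:Z).
Proof.
move=> lolo' f0; transitivity (\sum_(k <- zrange lo (lo + T%:Z)) f k).
  rewrite [RHS](bigID (fun k => lo' <= k)) /= [X in _ = _ + X]big1 ?addr0.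
    rewrite -[RHS]big_filter; apply: perm_big; apply: uniq_perm.
    - exact: zrange_uniq.
    - exact/filter_uniq/zrange_uniq.
    - move=> k; rewrite mem_filter !mem_zrange; lia.
  by move=> k; rewrite -ltNge; apply: f0.
rewrite /zrange ifT; last by lia.
rewrite big_map -[X in iota _ X](_ : T.+1 = _); last by lia.
by rewrite -(subn0 T.+1) -/(index_iota 0 T.+1) big_mkord.
Qed.

Lemma vmin_le r (u : 'I_r -> int) l : vmin u <= u l.
Proof.
rewrite /vmin; have : u l \in codom u by apply: codom_f.
move: (head 0 _) => x0; elim: (codom u) => //= x s IH.
rewrite inE big_cons ge_min => /orP[/eqP <-|/IH ->]; rewrite ?lexx ?orbT //.
Qed.

Lemma vmax_ge r (u : 'I_r -> int) l : u l <= vmax u.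
Proof.
rewrite /vmax; have : u l \in codom u by apply: codom_f.
move: (head 0 _) => x0; elim: (codom u) => //= x s IH.
rewrite inE big_cons le_max => /orP[/eqP <-|/IH ->]; rewrite ?lexx ?orbT //.
Qed.

(** Extended by zero, [beta k] is the backward difference of order p + 1 of S; summation leaves the
    one of order p at j0 + p. *)
Lemma sum_beta (F : fieldType) r (a b : 'I_r -> F) (m n : 'I_r -> int)
    (p : nat) (j0 : int) : pdeg m n = p%:Z ->
  \sum_(k <- zrange (- vmax n) (j0 + p%:Z)) beta a b m n k
  = \sum_(t < p.+1) 'C(p, t)%:R * (-1) ^+ (p - t)
                    * \sum_i summand a b m n i (j0 + t%:Z).
Proof.
move=> pE; pose S j := \sum_i summand a b m n i j.
have S0 j : j < - vmax n -> S j = 0.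
  move=> hj; apply: big1 => i _; rewrite /summand ifF //.
  by have := vmax_ge n i; lia.
(* All sums start at lo = min(j0, - n_max), with u = j0 - lo. *)
have [u [lo [loE lole]]] : exists u : nat, exists lo,
    j0 + p%:Z = lo + (u + p)%N%:Z /\ lo <= - vmax n.
  exists `|(j0 - Num.min j0 (- vmax n))%R|%N, (Num.min j0 (- vmax n)); lia.
rewrite loE sum_zrange //; last first.
  by move=> k hk; rewrite /beta /zrange ifF ?big_nil //; lia.
transitivity (\sum_(k < (u + p).+1) \sum_(j < k.+1)
    'C(p.+1, k - j)%:R * (-1) ^+ (k - j) * S (lo + j%:Z)).
  apply: eq_bigr => k _; rewrite /beta pE sum_zrange; last 2 first.
  - lia.
  (* Below either cutoff nothing is lost: S vanishes under - n_max, the binomial under k - p - 1. *)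
  - move=> j hj; have [/S0 Sj|hj'] := ltP j (- vmax n).
      by rewrite -/(S j) Sj mulr0.
    by rewrite bin_small ?mul0r //; lia.
  apply: eq_bigr => j _; have jk : (j <= k)%N by rewrite -ltnS.
  have -> : lo + k%:Z - (lo + j%:Z) = (k - j)%N%:Z by lia.
  by rewrite -exprnP; congr ('C(_, _)%:R * _ * _); lia.
rewrite (sum_backward_diff (fun j => S (lo + j%:Z))).
rewrite -addnS big_split_ord /= big1 ?add0r => [|j _]; last first.
  by rewrite bin_small ?mul0r //; have := ltn_ord j; lia.
apply: eq_bigr => t _; have tp : (t <= p)%N by rewrite -ltnS.
rewrite subnDl bin_sub //; congr (_ * _ * S _); lia.
Qed.

(** * Evaluation in closed form *)

Lemma pochz_opp (F : fieldType) (c : F) k :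
  pochz c (1 - k.+1%:Z) = (-1) ^+ k / poch (1 - c) k.
Proof.
case: k => [|k]; first by rewrite /= /poch !big_ord0 divr1.
by have -> : 1 - k.+2%:Z = Negz k by lia.
Qed.

Lemma pochz_wd_opp (F : fieldType) (c : F) k :
  pochz_wd c (1 - k.+1%:Z) -> poch (1 - c) k != 0.
Proof.
case: k => [|k]; first by rewrite /poch big_ord0 oner_eq0.
by have -> : 1 - k.+2%:Z = Negz k by lia.
Qed.

Lemma falling_poch (F : fieldType) (c : F) p k :
  \prod_(i < p) (c + (p + k)%:R - i%:R) = poch (c + 1 + k%:R) p.
Proof.
rewrite (reindex_inj rev_ord_inj); apply: eq_bigr => t _ /=.
rewrite natrB // -natr1 natrD; ring.
Qed.

(** From j = - m_min on, the indices m_l + j are natural. Padding by e = J - t makes the poles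
    independent of t, so the difference can be taken inside the residue sum. *)
Lemma sum_summands (F : numFieldType) r (a b : 'I_r.+1 -> F)
    (m n : 'I_r.+1 -> int) (p : nat) :
  (forall i j, i != j -> forall z : int, a i - a j != z%:~R) ->
  \sum_i m i - \sum_i n i = (p + r)%N%:Z ->
  (forall i j, - vmin m <= j <= p%:Z - vmin m -> 0 <= j + n i ->
     summand_wd a b m n i j) ->
  \sum_(t < p.+1) 'C(p, t)%:R * (-1) ^+ (p - t)
     * (\sum_i summand a b m n i (- vmin m + t%:Z))
  = poch (1 - nu a b + r%:R) p.
Proof.
move=> aZ MN wd; set j0 := - vmin m.
pose mm l := `|(m l + j0)%R|%N.
have mmE l : (mm l)%:Z = m l + j0.
  by rewrite gez0_abs // /j0 subr_ge0 vmin_le.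
(* Large enough for p differences and for every n_l + j0 + 1 + J to be nonnegative. *)
pose J := (p + \sum_l `|(n l + j0 + 1)%R|)%N.
have pJ : (p <= J)%N by rewrite leq_addr.
pose K l := `|(n l + j0 + 1 + J%:Z)%R|%N.
have KE l : (K l)%:Z = n l + j0 + 1 + J%:Z.
  rewrite gez0_abs //.
  have : (`|(n l + j0 + 1)%R| <= J)%N.
    by rewrite /J (bigD1 l) //= addnCA leq_addr.
  lia.
pose u l := 1 - b l; pose v l := - a l + (n l + j0 + 1)%:~R.
pose D (w : {l & 'I_(K l)}) := \prod_(w' | w' != w) (pole a w - pole a w').
have SE (t : 'I_p.+1) : \sum_i summand a b m n i (j0 + t%:Z)
    = \sum_w (numer u v mm J t).[pole a w] / D w.
  have tp : (t <= p)%N by rewrite -ltnS.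
  rewrite -(@sig_big_dep _ _ _ _ (fun l => 'I_(K l)) xpredT (fun _ => xpredT)
    (fun l s => (numer u v mm J t).[pole a (Tagged (fun l => 'I_(K l)) s)]
       / D (Tagged (fun l => 'I_(K l)) s))) /=.
  apply: eq_bigr => i _.
  rewrite (@summand_residues _ _ _ b m n aZ K i (j0 + t%:Z) (J - t)
     (fun l => mm l + t)%N); first last.
  - move=> q0; have [] := wd i (j0 + t%:Z) _ q0; first by lia.
    by move=> _ _ h.
  - by move=> l; rewrite KE; lia.
  - by move=> l; rewrite PoszD mmE; ring.
  apply: eq_bigr => s _; congr (_ / _); rewrite horner_prod.
  apply: eq_bigr => l _; rewrite hornerM !horner_rpoly; congr (_ * poch _ _).
  by rewrite /v /pole /= !intrD; ring.
under eq_bigr do rewrite SE mulr_sumr.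
rewrite exchange_big /=.
have [szW WE] := diff_numer_top u v mm pJ.
set W := \sum_(i < p.+1) _ in szW WE; set d := (_ + _)%N in szW WE.
(* M - N = p + r makes [d] exactly one less than the number of poles, as [sum_residues] requires. *)
have dE : #|{: {l & 'I_(K l)}}| = d.+1.
  rewrite -sum1_card -(@sig_big_dep _ _ _ _ (fun l => 'I_(K l)) xpredT
    (fun _ => xpredT) (fun _ _ => 1%N)) /=.
  rewrite (eq_bigr K) => [|l _]; last by rewrite sum1_card card_ord.
  have sumZ (f : 'I_r.+1 -> nat) : (\sum_l f l)%N%:Z = \sum_l (f l)%:Z.
    by rewrite -natz natr_sum; apply: eq_bigr => l _; rewrite natz.
  apply/eqP; rewrite -eqz_nat /d intS PoszD !sumZ addrCA.
  rewrite (eq_bigr (fun l => (mm l + (J - p))%N%:Z + ((n l - m l) + (1 + p%:Z)))).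
    rewrite big_split /= (inj_eq (addrI _)) big_split /= sumrB.
    rewrite sumr_const card_ord -[X in X + _]opprB MN -mulr_natr natz.
    by apply/eqP; rewrite !PoszD PoszM intS; ring.
  by move=> l _; rewrite KE PoszD mmE; lia.
transitivity (\sum_w W.[pole a w] / D w).
  apply: eq_bigr => w _; rewrite horner_sum mulr_suml; apply: eq_bigr => t _.
  rewrite mulrA; congr (_ / _).
  by rewrite !hornerM horner_exp hornerN hornerMn hornerC.
rewrite sum_residues ?dE //; last exact: pole_inj.
(* The sum of u_l + m_l + j0 - v_l is M - N - nu = p + r - nu. *)
rewrite WE [1 - _]addrC -falling_poch; apply: eq_bigr => i _; congr (_ - _).
rewrite -[(p + r)%:R]/((p + r)%N%:Z%:~R) -MN intrB !rmorph_sum /= /nu -sumrN.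
rewrite -sumrB -big_split; apply: eq_bigr => l _ /=.
rewrite -[(mm l)%:R]/((mm l)%:Z%:~R) mmE /u /v !intrD; ring.
Qed.

Theorem theorem6p3 (R : realType) (r : nat) (a b : 'I_r -> R[i])
    (m n : 'I_r -> int)
    (r_ge1 : (1 <= r)%N)
    (a_nonint : forall i j : 'I_r, i != j ->
       forall z : int, a i - a j != z%:~R)
    (wd : well_defined a b m n)
    (Re_nu_lt : complex.Re (nu a b) - (\sum_i m i)%:~R + (\sum_i n i)%:~R - 1
                < 0)
    (Re_nu_gt : - complex.Re (nu a b) + r%:R - 1 < 0) :
  \sum_(k <- zrange (- vmax n) (pdeg m n - vmin m)) beta a b m n k
  = (-1) ^+ (r - 1) * pochz (nu a b) (1 - r%:Z)
    * pochz (1 - nu a b) (\sum_i m i - \sum_i n i).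
Proof.
case: r r_ge1 a b m n a_nonint wd Re_nu_lt Re_nu_gt => // r _ a b m n aZ wd lt gt.
(* As r is now one less than the dimension, the bounds read r < Re nu < M - N + 1, so M - N >= r by
   integrality. *)
have [p pE] : exists p : nat, \sum_i m i - \sum_i n i = (p + r)%N%:Z.
  have : (r%:Z)%:~R < (\sum_i m i - \sum_i n i + 1)%:~R :> R.
    rewrite intrD intrB -[X in X < _]/(r%:R).
    by move: lt gt; rewrite -natr1; lra.
  rewrite ltr_int => h; exists `|(\sum_i m i - \sum_i n i - r%:Z)%R|%N; lia.
have pdegE : pdeg m n = p%:Z.
  by rewrite /pdeg pE; lia.
case: wd => wd /pochz_wd_opp nz _.
rewrite pdegE addrC (sum_beta _ _ _ pdegE) sum_summands //; last first.
  move=> i j hj q0; apply: wd => //; rewrite pdegE.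
  by have := vmax_ge n i; lia.
(* (1 - nu)_{r + p} splits off (1 - nu)_r, which cancels the denominator of (nu)_{-r}; it is nonzero
   by [nz]. *)
rewrite pE pochz_opp subn1 /= addnC pochD.
rewrite [_ * (_ / _)]mulrA -exprD addnn -signr_odd odd_double mul1r.
by rewrite mulKf.
Qed.
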